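(* Let $n=\pi^{\alpha}M^2$ be an odd positive integer with $\sigma(n)=2n$, where $\pi$ is prime, $M$ is a positive integer with $\gcd(\pi,M)=1$, and $\pi\equiv\alpha\equiv 1\pmod 4$. Then $$\sigma(M^2)\equiv 1\pmod 4 \iff \pi\equiv\alpha\pmod 8,$$ $$\sigma(M^2)\equiv 3\pmod 4 \iff \pi\equiv\alpha+4\pmod 8.$$ In particular, if $M^2=\prod_i p_i^{2\beta_i}$ with all primes $p_i\equiv 1\pmod 4$, or $M^2=\prod_j q_j^{2\gamma_j}$ with all primes $q_j\equiv 3\pmod 4$, then $\pi\equiv\alpha\pmod 8$.
   Context: $\sigma(m)$ denotes the sum of the positive divisors of $m$. *)

(* Defs.v *)
From mathcomp Require Import all_boot.

Set Implicit Arguments.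
Unset Strict Implicit.
Unset Printing Implicit Defensive.

(* [divisors 0] is empty, so [sigma 0 = 0]; only [0 < m] is meaningful. *)
Definition sigma (m : nat) : nat := \sum_(d <- divisors m) d.

(* Main.v *)
(* Write S = sigma (M ^ 2), pi = 4k + 1 and alpha = 4l + 1. Pairing consecutive
   powers, sigma (pi ^ alpha) = (2l + 1)(1 + pi) mod 16, whereas
   2n = 2 pi mod 16 because odd squares are 1 mod 8; dividing by 2 gives
   (2l + 1)(2k + 1) S = 1 mod 4, so S mod 4 is decided by the parity of k + l.
   If all primes of M are 1 mod 4, then so are all primes of n, hence all those
   of its divisor S, and S = 1 mod 4. If they are all 3 mod 4, then each
   sigma (q ^ (2 c)) = 1 + q (1 + q) + q ^ 3 (1 + q) + ... is 1 mod 4, and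
   S = 1 mod 4 by multiplicativity. *)
Require Import Defs.
From mathcomp Require Import all_boot zify.

Set Implicit Arguments.
Unset Strict Implicit.
Unset Printing Implicit Defensive.

(** The two gcds are coprime divisors of [d], so their product divides [d]; conversely, expanding it
    gives a gcd of four products, each a multiple of [d]. *)
Lemma dvdn_coprime_gcdM m n d :
  coprime m n -> d %| m * n -> gcdn d m * gcdn d n = d.
Proof.
move=> co_mn dv_d; apply/eqP; rewrite eqn_dvd; apply/andP; split.
  rewrite Gauss_dvd ?dvdn_gcdl //.
  exact: coprime_dvdl (dvdn_gcdr d m) (coprime_dvdr (dvdn_gcdr d n) co_mn).
by rewrite muln_gcdl !muln_gcdr !dvdn_gcd dvdn_mulr // dvdn_mulr // dvdn_mull.
Qed.

Lemma gcdn_coprime_mul m n d e :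
  coprime m n -> d %| m -> e %| n -> gcdn (d * e) m = d.
Proof.
move=> co_mn dv_d dv_e; rewrite gcdnC Gauss_gcdl.
  by apply/gcdn_idPr.
by rewrite (coprime_dvdr dv_e).
Qed.

(** Multiplication maps pairs of divisors of [m] and [n] bijectively onto divisors of [m * n]; the
    inverse takes gcds with [m] and with [n]. *)
Lemma sigmaM m n :
  0 < m -> 0 < n -> coprime m n -> sigma (m * n) = sigma m * sigma n.
Proof.
move=> m_gt0 n_gt0 co_mn; rewrite /sigma big_distrlr /=.
rewrite -(big_allpairs_dep (h := muln) (r2 := fun=> divisors n) (F := id)).
apply: perm_big; apply: uniq_perm; first exact: divisors_uniq.
  apply: allpairs_uniq; try exact: divisors_uniq.
  move=> [d e] [d' e'] /allpairsP[[a b] /= [a_m b_n [-> ->]]].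
  case/allpairsP=> [[a' b'] /= [a'_m b'_n [-> ->]]] eq_ab.
  move: a_m b_n a'_m b'_n; rewrite -!dvdn_divisors // => a_m b_n a'_m b'_n.
  have eq_a : a = a'.
    by rewrite -(gcdn_coprime_mul co_mn a_m b_n) eq_ab (gcdn_coprime_mul co_mn).
  have co_nm : coprime n m by rewrite coprime_sym.
  have eq_b : b = b'.
    rewrite -(gcdn_coprime_mul co_nm b_n a_m) mulnC eq_ab mulnC.
    by rewrite (gcdn_coprime_mul co_nm).
  by rewrite eq_a eq_b.
move=> d; rewrite -dvdn_divisors ?muln_gt0 ?m_gt0 //; apply/idP/allpairsP.
  move=> dv_d; exists (gcdn d m, gcdn d n) => /=.
  by rewrite -!dvdn_divisors // !dvdn_gcdr dvdn_coprime_gcdM.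
case=> [[a b] /= [a_m b_n ->]].
by rewrite dvdn_mul // dvdn_divisors.
Qed.

Lemma sigma_pfactor p k : prime p -> sigma (p ^ k) = \sum_(i < k.+1) p ^ i.
Proof.
move=> p_pr; rewrite /sigma -(big_mkord xpredT (fun i => p ^ i)).
rewrite -(big_map (fun i => p ^ i) xpredT id).
apply: perm_big; apply: uniq_perm; first exact: divisors_uniq.
  by rewrite map_inj_uniq ?iota_uniq //; apply/expnI/prime_gt1.
move=> d; rewrite -dvdn_divisors ?expn_gt0 ?prime_gt0 //.
apply/(dvdn_pfactor _ _ p_pr)/mapP => -[i].
  by move=> le_ik ->; exists i; rewrite // mem_index_iota.
by rewrite mem_index_iota => le_ik ->; exists i.
Qed.

Lemma odd_sqr_mod8 m : odd m -> m ^ 2 = 1 %[mod 8].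
Proof.
move=> m_odd; rewrite -modnXm.
have : odd (m %% 8) by rewrite odd_mod.
have := @ltn_pmod m 8 isT.
by case: (m %% 8) => [|[|[|[|[|[|[|[|]]]]]]]].
Qed.

Lemma odd_exp_mod8 p a : odd p -> odd a -> p ^ a = p %[mod 8].
Proof.
move=> p_odd a_odd; rewrite -(odd_double_half a) a_odd -mul2n expnS expnM.
by rewrite -modnMmr -modnXm odd_sqr_mod8 // modnXm exp1n modnMmr muln1.
Qed.

(** Each of the [m] pairs of consecutive powers is an even power of [p], which is 1 mod 8, times the
    even number [p.+1]; that factor 2 lifts the congruence to 16. *)
Lemma odd_geometric_mod16 p m :
  odd p -> \sum_(i < m.*2) p ^ i = m * p.+1 %[mod 16].
Proof.
move=> p_odd; elim: m => [|m IHm]; first by rewrite big_ord0.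
rewrite doubleS !big_ord_recr /= -addnA -modnDml IHm modnDml.
rewrite mulSnr -modnDmr -[RHS]modnDmr; congr ((_ + _) %% _).
have -> : p ^ m.*2 + p ^ m.*2.+1 = p ^ m.*2 * p.+1 by rewrite mulnS expnSr.
have /eqP : (p ^ 2) ^ m = 1 %[mod 8].
  by rewrite -modnXm odd_sqr_mod8 // modnXm exp1n.
rewrite -expnM mul2n => /eqP pm.
have : p ^ m.*2 = p ^ m.*2 %/ 8 * 8 + 1 by rewrite {1}(divn_eq (p ^ m.*2) 8) pm.
move: (_ %/ 8) => c ->.
have -> : p.+1 = 2 * p.+1./2 by lia.
move: (_./2) => h; rewrite mulnDl mul1n.
by rewrite (_ : c * 8 * _ = c * h * 16) ?modnMDl //; lia.
Qed.

(** Induction that splits off the full power of one prime, so that the cofactor is coprime to it, as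
    multiplicativity of [sigma] requires. *)
Lemma dvdn_prime_ind (P : nat -> Prop) :
  P 1 ->
  (forall p k m, prime p -> 0 < m -> coprime p m -> P m -> P (p ^ k.+1 * m)) ->
  forall m, 0 < m -> P m.
Proof.
move=> P1 PM; elim/ltn_ind=> m IHm m_gt0.
have [m_le1|m_gt1] := leqP m 1; first by have -> : m = 1 by lia.
have p_pr := pdiv_prime m_gt1.
have [m' co_pm' mE] := pfactor_coprime p_pr m_gt0.
have lt0 : 0 < logn (pdiv m) m.
  by rewrite logn_gt0 mem_primes p_pr m_gt0 pdiv_dvd.
have m'_gt0 : 0 < m' by move: m_gt0; rewrite {1}mE muln_gt0 => /andP[].
rewrite mE mulnC -(prednK lt0); apply: PM => //; apply: IHm => //.
rewrite {1}mE -{1}[m']muln1 ltn_pmul2l //.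
by rewrite -{1}(expn0 (pdiv m)) ltn_exp2l // prime_gt1.
Qed.

Lemma primes_1mod4 m :
  0 < m -> (forall p, prime p -> p %| m -> p = 1 %[mod 4]) -> m = 1 %[mod 4].
Proof.
elim/dvdn_prime_ind=> // p k {}m p_pr m_gt0 co_pm IHm p1.
rewrite -modnMml -modnXm (p1 p) ?dvdn_mulr ?dvdn_exp //.
rewrite modnXm exp1n modnMml mul1n.
by apply: IHm => q q_pr q_m; apply: p1; rewrite ?dvdn_mull.
Qed.

(** After the initial 1, consecutive powers pair up into multiples of [p.+1], hence of 4. *)
Lemma sigma_even_pfactor_3mod4 p k :
  prime p -> p = 3 %[mod 4] -> sigma (p ^ k.*2) = 1 %[mod 4].
Proof.
move=> p_pr p3; rewrite sigma_pfactor //; elim: k => [|k IHk].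
  by rewrite big_ord1.
rewrite doubleS 2!big_ord_recr /= -addnA -modnDml IHk modnDml.
have -> : p ^ k.*2.+1 + p ^ k.*2.+2 = p ^ k.*2.+1 * p.+1.
  by rewrite mulnS -expnSr.
have -> : p.+1 = 4 * (p.+1 %/ 4) by lia.
by rewrite mulnCA mulnC addnC modnMDl.
Qed.

Lemma sigma_sqr_3mod4 m :
  0 < m -> (forall p, prime p -> p %| m -> p = 3 %[mod 4]) ->
  sigma (m ^ 2) = 1 %[mod 4].
Proof.
elim/dvdn_prime_ind=> [_|p k {}m p_pr m_gt0 co_pm IHm p3].
  (* Here 1 is viewed as a power of the prime 2, so that the prime power formula applies. *)
  by rewrite -(expn0 2) -expnM sigma_pfactor // big_ord1.
rewrite expnMn sigmaM ?expn_gt0 ?m_gt0 ?prime_gt0 //; last first.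
  by rewrite coprimeXl // coprimeXl // coprimeXr.
rewrite -expnM muln2 -modnMm sigma_even_pfactor_3mod4 //; last first.
  by apply: p3; rewrite ?dvdn_mulr ?dvdn_exp.
by rewrite IHm // => q q_pr q_m; apply: p3; rewrite ?dvdn_mull.
Qed.

Lemma prime_dvd_prod_exp m r (p e : 'I_r -> nat) q :
  m ^ 2 = \prod_(i < r) p i ^ e i -> (forall i, prime (p i)) ->
  prime q -> q %| m -> exists i, q = p i.
Proof.
move=> mE p_pr q_pr q_m; have : q %| m ^ 2 by rewrite dvdn_exp.
rewrite mE Euclid_dvd_prod // big_has => /hasP[i _].
by rewrite Euclid_dvdX // dvdn_prime2 // => /andP[/eqP -> _]; exists i.
Qed.

Lemma sigma_cofactor_mod4 p a m k l :
  prime p -> p = 4 * k + 1 -> a = 4 * l + 1 -> odd m -> coprime p m ->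
  sigma (p ^ a * m ^ 2) = 2 * (p ^ a * m ^ 2) ->
  (2 * l + 1) * (2 * k + 1) * sigma (m ^ 2) = 1 %[mod 4].
Proof.
move=> p_pr pE aE m_odd co_pm; have p_odd : odd p by lia.
have a_odd : odd a by lia.
rewrite sigmaM ?expn_gt0 ?odd_gt0 //; last by rewrite coprimeXl // coprimeXr.
rewrite sigma_pfactor // => perf.
(* The [a.+1 = 4 * l + 2] terms form [2 * l + 1] pairs. *)
have geom : \sum_(i < a.+1) p ^ i = (2 * l + 1) * p.+1 %[mod 16].
  by rewrite -odd_geometric_mod16 // (_ : a.+1 = (2 * l + 1).*2) //; lia.
have n_mod8 : p ^ a * m ^ 2 = p %[mod 8].
  by rewrite -modnMm odd_sqr_mod8 // odd_exp_mod8 // modnMm muln1.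
have : (2 * l + 1) * p.+1 * sigma (m ^ 2) = 2 * p %[mod 16].
  by rewrite -modnMml -geom modnMml perf -!(@muln_modr 2 _ 8) n_mod8.
rewrite (_ : (2 * l + 1) * p.+1 * _ =
  2 * ((2 * l + 1) * (2 * k + 1) * sigma (m ^ 2))); last by lia.
(* From [2 * x = 2 * p] mod 16 follows [x = p] mod 8, and [p] is 1 mod 4. *)
by move: (_ * _ * sigma _) => x; lia.
Qed.

(** An odd number is its own inverse mod 4, and the product of the two odd factors is
    [1 + 2 * (k + l)] mod 4. *)
Lemma odd_mul_mod4 k l s :
  (2 * l + 1) * (2 * k + 1) * s = 1 %[mod 4] ->
  s = 1 + 2 * (k + l) %[mod 4].
Proof.
rewrite -modnMm -(modnMml (2 * l + 1)) -(modnMmr _ (2 * k + 1)).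
have -> : (2 * l + 1) %% 4 = 2 * (l %% 2) + 1 by lia.
have -> : (2 * k + 1) %% 4 = 2 * (k %% 2) + 1 by lia.
have -> : (1 + 2 * (k + l)) %% 4 = (1 + 2 * (k %% 2 + l %% 2)) %% 4 by lia.
have := @ltn_pmod k 2 isT; have := @ltn_pmod l 2 isT; have := @ltn_pmod s 4 isT.
by case: (k %% 2) => [|[|]] //; case: (l %% 2) => [|[|]] //;
  case: (s %% 4) => [|[|[|[|]]]].
Qed.

Theorem theorem3p3 (n pi alpha M : nat)
    (n_odd : odd n)
    (n_perfect : sigma n = 2 * n)
    (nE : n = pi ^ alpha * M ^ 2)
    (pi_prime : prime pi)
    (M_gt0 : 0 < M)
    (pi_coprime : gcdn pi M = 1)
    (pi_mod4 : pi = 1 %[mod 4])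
    (alpha_mod4 : alpha = 1 %[mod 4]) :
  (sigma (M ^ 2) = 1 %[mod 4] <-> pi = alpha %[mod 8]) /\
  (sigma (M ^ 2) = 3 %[mod 4] <-> pi = alpha + 4 %[mod 8]) /\
  ((exists (r : nat) (p beta : 'I_r -> nat),
      M ^ 2 = \prod_(i < r) p i ^ (2 * beta i) /\
      (forall i, prime (p i) /\ p i = 1 %[mod 4])) \/
   (exists (s : nat) (q gamma : 'I_s -> nat),
      M ^ 2 = \prod_(j < s) q j ^ (2 * gamma j) /\
      (forall j, prime (q j) /\ q j = 3 %[mod 4])) ->
   pi = alpha %[mod 8]).
Proof.
have co_pM : coprime pi M by apply/eqP.
have M_odd : odd M by move: n_odd; rewrite nE oddM !oddX => /andP[_].
have [k piE] : exists k, pi = 4 * k + 1 by exists (pi %/ 4); lia.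
have [l alphaE] : exists l, alpha = 4 * l + 1 by exists (alpha %/ 4); lia.
have perf := n_perfect; rewrite nE in perf.
have := odd_mul_mod4 (sigma_cofactor_mod4 pi_prime piE alphaE M_odd co_pM perf).
move=> sig_mod4.
(* Both sides say that [k + l] is even, since [pi] and [alpha] differ by 4 times the difference of
   [k] and [l]. *)
have S1 : sigma (M ^ 2) = 1 %[mod 4] <-> pi = alpha %[mod 8].
  by move: (sigma _) sig_mod4 => s; lia.
split=> //; split; first by move: (sigma _) sig_mod4 => s; lia.
case=> [[r [p [beta [ME p_pr]]]]|[r [p [beta [ME p_pr]]]]]; apply/S1; last first.
  apply: sigma_sqr_3mod4 => // q q_pr q_M.
  have [i ->] := prime_dvd_prod_exp ME (fun i => (p_pr i).1) q_pr q_M.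
  exact: (p_pr i).2.
have S_odd : odd (sigma (M ^ 2)) by move: (sigma _) sig_mod4 => s; lia.
apply: primes_1mod4 => [|q q_pr q_S]; first exact: odd_gt0.
(* [sigma (M ^ 2)] divides [sigma n], which is [2 * n]; being odd, it divides [n], and so does
   [q]. *)
have : q %| pi ^ alpha * M ^ 2.
  have co_S2 : coprime (sigma (M ^ 2)) 2 by rewrite coprimen2.
  apply: dvdn_trans q_S _; rewrite -(Gauss_dvdr _ co_S2) -perf.
  rewrite sigmaM; first by rewrite dvdn_mull.
  - by rewrite expn_gt0 prime_gt0.
  - by rewrite expn_gt0 M_gt0.
  by rewrite coprimeXl // coprimeXr.
(* Either [q] is [pi], which is 1 mod 4, or [q] is one of the [p i]. *)
rewrite Euclid_dvdM // !Euclid_dvdX // => /orP[/andP[]|/andP[q_M _]].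
  by rewrite dvdn_prime2 // => /eqP ->.
have [i ->] := prime_dvd_prod_exp ME (fun i => (p_pr i).1) q_pr q_M.
exact: (p_pr i).2.
Qed.
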